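(* Let $s\in(0,d]$ and $\theta\in(0,1)$. If $X\subseteq\mathbb{R}^d$ is bounded, then \[ \overline{\dim}_{\mathrm{B}}^{s}X\ \geq\ \overline{\dim}_{\mathrm{B}}X-\max\big\{0,\ \overline{\dim}_{\mathrm{A}}^\theta X-s,\ (\dim_{\mathrm{A}}X-s)(1-\theta)\big\}. \]
   Context: For non-empty bounded $E\subseteq\mathbb{R}^d$ and $r>0$, $N_r(E)$ is the minimal number of sets of diameter $r$ needed to cover $E$, and $\overline{\dim}_{\mathrm{B}}E=\limsup_{r\to0}\frac{\log N_r(E)}{-\log r}$. The Assouad dimension $\dim_{\mathrm{A}}X$ is the infimum of $\alpha>0$ for which there is $C>0$ with $N_r(B(x,R)\cap X)\leq C(R/r)^\alpha$ for all $0<r<R$ and $x\in X$; the upper Assouad spectrum $\overline{\dim}_{\mathrm{A}}^{\theta}X$ is the infimum of $\alpha$ for which there is $C>0$ with $N_r(B(x,R)\cap X)\leq C(R/r)^\alpha$ for all $0<r\leq R^{1/\theta}<R<1$ and $x\in X$. Box dimension profiles: for $s\in[0,d]$ and $r>0$ let $\phi_r^s(x)=\min\{1,(r/|x|)^s\}$ for $x\in\mathbb{R}^d$. For non-empty compact $X$, the capacity $C_r^s(X)$ is defined by $1/C_r^s(X)=\inf_{\mu}\iint\phi_r^s(x-y)\,d\mu(x)\,d\mu(y)$, the infimum over Borel probability measures $\mu$ supported on $X$; for bounded $X$ the capacity is that of its closure. The upper box dimension profile is $\overline{\dim}_{\mathrm{B}}^sX=\limsup_{r\to0}\frac{\log C_r^s(X)}{-\log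 r}$. *)

(* Defs.v *)
From HB Require Import structures.
From mathcomp Require Import all_boot all_order all_algebra.
From mathcomp Require Import all_classical all_reals all_analysis.
Set Implicit Arguments. Unset Strict Implicit. Unset Printing Implicit Defensive.
Import Order.TTheory GRing.Theory Num.Theory.
Import numFieldNormedType.Exports.
Local Open Scope classical_set_scope.
Local Open Scope ring_scope.

Section Defs.
Variables (R : realType) (d : nat).

Definition enorm (x : 'rV[R]_d) : R := Num.sqrt (\sum_(i < d) x ord0 i ^+ 2).

Definition edist (x y : 'rV[R]_d) : R := enorm (x - y).

Definition ebounded (X : set 'rV[R]_d) : Prop :=
  exists M : R, forall x, X x -> enorm x <= M.

Definition eball (x : 'rV[R]_d) (rho : R) : set 'rV[R]_d :=
  [set y | edist y x <= rho].

Definition Ncov (r : R) (E : set 'rV[R]_d) : R :=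
  fine (ereal_inf [set (n%:R)%:E | n in
    [set n : nat | exists U : 'I_n -> set 'rV[R]_d,
       (forall i x y, U i x -> U i y -> edist x y <= r) /\
       E `<=` \bigcup_(i in setT) U i]]).

Definition limsup0 (f : R -> R) : \bar R :=
  ereal_inf [set ereal_sup [set (f r)%:E | r in [set r : R | 0 < r < delta]]
            | delta in [set delta : R | 0 < delta]].

Definition ubox_dim (E : set 'rV[R]_d) : \bar R :=
  limsup0 (fun r => ln (Ncov r E) / (- ln r)).

Definition assouad_dim (X : set 'rV[R]_d) : \bar R :=
  ereal_inf [set alpha%:E | alpha in [set alpha : R | 0 < alpha /\
    exists C : R, 0 < C /\
      forall (r rho : R) (x : 'rV[R]_d), 0 < r -> r < rho -> X x ->
        Ncov r (eball x rho `&` X) <= C * powR (rho / r) alpha]].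

Definition upper_assouad_spectrum (theta : R) (X : set 'rV[R]_d) : \bar R :=
  ereal_inf [set alpha%:E | alpha in [set alpha : R |
    exists C : R, 0 < C /\
      forall (r rho : R) (x : 'rV[R]_d),
        0 < r -> r <= powR rho theta^-1 -> powR rho theta^-1 < rho -> rho < 1 ->
        X x ->
        Ncov r (eball x rho `&` X) <= C * powR (rho / r) alpha]].

Definition borelRd := g_sigma_algebraType (@open 'rV[R]_d).

Definition phi_rs (s r : R) (x : 'rV[R]_d) : R :=
  if enorm x == 0 then 1 else Order.min 1 (powR (r / enorm x) s).

Definition energy (s r : R) (mu : probability borelRd R) : \bar R :=
  (\int[mu]_x \int[mu]_y (phi_rs s r (x - y))%:E)%E.

Definition supported_on (mu : probability borelRd R) (K : set 'rV[R]_d) : Prop :=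
  mu (~` K) = 0%E.

Definition inv_capacity (s r : R) (X : set 'rV[R]_d) : \bar R :=
  ereal_inf [set energy s r mu | mu in
              [set mu : probability borelRd R | supported_on mu (closure X)]].

Definition capacity (s r : R) (X : set 'rV[R]_d) : R :=
  (fine (inv_capacity s r X))^-1.

Definition ubox_profile (s : R) (X : set 'rV[R]_d) : \bar R :=
  limsup0 (fun r => ln (capacity s r X) / (- ln r)).

End Defs.

(* Main.v *)
(** The capacity is bounded below by testing the energy on the uniform measure
    of a maximal [r/2]-separated subset of [X], which has at least [N_r(X)]
    points.  For a fixed centre, split the energy over the scales
    [r^(1 - k tau)], [k <= K], with [tau] fixed and [K tau > 1]: the number of
    scales does not depend on [r], and each contributes at most a constant times
    [r^(-(m + s tau))].  The number of points in a ball is estimated by the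
    Assouad dimension when the radius is below [r^theta], by the Assouad spectrum
    for radii between [r^theta] and [1], and by the spectrum after covering [X]
    by finitely many sets of diameter [1/2] for the remaining radii.  Finally
    [tau] tends to [0]. *)

Require Import Defs.
From HB Require Import structures.
From mathcomp Require Import all_boot all_order all_algebra.
From mathcomp Require Import all_classical all_reals all_analysis.
From mathcomp Require Import measurable_realfun ring lra.
Import Order.TTheory GRing.Theory Num.Theory.
Import numFieldNormedType.Exports.
Local Open Scope classical_set_scope.
Local Open Scope ring_scope.

(* MathComp-Analysis has its own [edist]. *)
Local Notation edist := Defs.edist.

(** * The Euclidean norm and its comparison with coordinates *)

Section EuclideanNorm.
Variables (R : realType) (d : nat).
Implicit Types (x y z : 'rV[R]_d) (c rho : R).

Lemma enorm_ge0 x : 0 <= enorm x. Proof. exact: sqrtr_ge0. Qed.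

Lemma enormN x : enorm (- x) = enorm x.
Proof. by congr Num.sqrt; apply: eq_bigr => i _; rewrite mxE sqrrN. Qed.

Lemma edistC x y : edist x y = edist y x.
Proof. by rewrite /edist -enormN opprB. Qed.

Lemma enorm_sqr x : enorm x ^+ 2 = \sum_(i < d) x ord0 i ^+ 2.
Proof. by rewrite sqr_sqrtr// sumr_ge0// => i _; exact: sqr_ge0. Qed.

Lemma enorm_le_sqr x rho : 0 <= rho ->
  (enorm x <= rho) = (\sum_(i < d) x ord0 i ^+ 2 <= rho ^+ 2).
Proof. by move=> r0; rewrite -enorm_sqr ler_pXn2r// nnegrE// enorm_ge0. Qed.

(* From [(a + b)^2 <= 2 a^2 + 2 b^2] coordinatewise, without Cauchy-Schwarz. *)
Lemma enormD_le2 x y rho :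
  enorm x <= rho -> enorm y <= rho -> enorm (x + y) <= 2 * rho.
Proof.
move=> xr yr; have r0 : 0 <= rho by exact: le_trans (enorm_ge0 x) xr.
rewrite enorm_le_sqr; last by lra.
rewrite enorm_le_sqr// in xr; rewrite enorm_le_sqr// in yr.
apply: (@le_trans _ _ (\sum_(i < d) (2 * x ord0 i ^+ 2 + 2 * y ord0 i ^+ 2))).
  by apply: ler_sum => i _; rewrite mxE; have := sqr_ge0 (x ord0 i - y ord0 i); nra.
by rewrite big_split/= -!mulr_sumr; lra.
Qed.

Lemma edist_le2 x y z rho :
  edist x z <= rho -> edist y z <= rho -> edist x y <= 2 * rho.
Proof.
move=> xz; rewrite edistC => zy.
by rewrite /edist -(subrKA z); exact: enormD_le2.
Qed.

Lemma coord_le_enorm x i : `|x ord0 i| <= enorm x.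
Proof.
rewrite -(ler_pXn2r (n := 2))// ?nnegrE ?enorm_ge0// enorm_sqr real_normK ?num_real//.
by rewrite (bigD1 i)//= lerDl sumr_ge0// => j _; exact: sqr_ge0.
Qed.

(** The constant [d.+1] replaces the sharp square root of [d]; it can serve as a divisor even when
    [d = 0]. *)
Lemma enorm_le_coord x c : 0 <= c ->
  (forall i, `|x ord0 i| <= c) -> enorm x <= d.+1%:R * c.
Proof.
move=> c0 xc; rewrite enorm_le_sqr ?mulr_ge0//.
apply: (@le_trans _ _ (\sum_(i < d) c ^+ 2)).
  apply: ler_sum => i _; rewrite -[leLHS]real_normK ?num_real//.
  by rewrite ler_pXn2r// nnegrE.
rewrite sumr_const card_ord -[leLHS]mulr_natl exprMn ler_wpM2r ?sqr_ge0//.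
by rewrite -natrX ler_nat expnS expn1 (leq_trans (leqnSn d))// leq_pmulr.
Qed.

End EuclideanNorm.

(** * Covering numbers and separated families *)

Section Covers.
Variables (R : realType) (d : nat).
Implicit Types (x y z : 'rV[R]_d) (r : R) (E X : set 'rV[R]_d).

Definition diam_cover r E (n : nat) := exists U : 'I_n -> set 'rV[R]_d,
  (forall i x y, U i x -> U i y -> edist x y <= r) /\
  E `<=` \bigcup_(i in setT) U i.

(** One finite cover makes the set of admissible counts non-empty, so the infimum is a minimum and
    [fine] acts on a finite value. *)
Lemma Ncov_attained r E n : diam_cover r E n ->
  exists2 m, diam_cover r E m & Ncov r E = m%:R.
Proof.
move=> En; have ex : exists m, `[< diam_cover r E m >] by exists n; apply/asboolP.
case: (ex_minnP ex) => m /asboolP Em mmin; exists m => //.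
rewrite /Ncov; set I := ereal_inf _; suff -> : I = m%:R%:E by [].
apply/eqP; rewrite eq_le; apply/andP; split.
  by apply: ereal_inf_lbound; exists m.
apply: le_ereal_inf_tmp => _ [k Ek <-]; rewrite lee_fin ler_nat.
by apply: mmin; apply/asboolP.
Qed.

Lemma Ncov_le r E n : diam_cover r E n -> Ncov r E <= n%:R.
Proof.
move=> En; rewrite /Ncov; set I := ereal_inf _.
have In : (I <= n%:R%:E)%E by apply: ereal_inf_lbound; exists n.
have I0 : (0 <= I)%E.
  by apply: le_ereal_inf_tmp => _ [k _ <-]; rewrite lee_fin.
by rewrite -lee_fin fineK// ge0_fin_numE// (le_lt_trans In)// ltry.
Qed.

Lemma ebounded_cover X r : ebounded X -> 0 < r -> exists n, diam_cover r X n.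
Proof.
(* Grid cells of side [h] have Euclidean diameter at most [d.+1 * h = r]; a cell is recorded by its
   integer coordinates, each at most [K]. *)
move=> [M XM] r0; pose h := r / d.+1%:R.
have h0 : 0 < h by rewrite divr_gt0.
pose g x i := Num.truncn ((x ord0 i + M) / h).
pose K := (Num.truncn ((M + M) / h)).
have gnn x i : X x -> 0 <= (x ord0 i + M) / h.
  move=> /XM xM; rewrite divr_ge0 ?(ltW h0)//.
  have := le_trans (coord_le_enorm _ _ x i) xM; rewrite ler_norml => /andP[? ?]; lra.
have gK x i : X x -> (g x i <= K)%N.
  move=> Xx; apply: le_truncn; rewrite ler_pM2r ?invr_gt0// lerD2r.
  have := le_trans (coord_le_enorm _ _ x i) (XM _ Xx).
  by rewrite ler_norml => /andP[? ?]; lra.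
pose F := {ffun 'I_d -> 'I_K.+1}; exists #|{: F}|.
exists (fun k => [set x | X x /\ forall i, g x i = (enum_val k : F) i]); split.
- move=> k x y [Xx gx] [Xy gy]; rewrite /edist.
  rewrite (_ : r = d.+1%:R * h); last by rewrite /h mulrC divfK.
  apply: enorm_le_coord => [|i]; first exact: ltW.
  have /andP[x1 x2] := truncn_itv (gnn x i Xx).
  have /andP[y1 y2] := truncn_itv (gnn y i Xy).
  have e : g x i = g y i by rewrite gx gy.
  rewrite -/(g x i) e in x1 x2; rewrite -/(g y i) in y1 y2.
  rewrite ler_pdivlMr// in x1; rewrite ltr_pdivrMr// in x2.
  rewrite ler_pdivlMr// in y1; rewrite ltr_pdivrMr// in y2.
  rewrite -natr1 mulrDl mul1r in x2; rewrite -natr1 mulrDl mul1r in y2.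
  by rewrite !mxE ler_norml; apply/andP; split; lra.
- move=> x Xx; exists (enum_rank [ffun i => inord (g x i)]) => //; split=> // i.
  by rewrite enum_rankK ffunE inordK// ltnS gK.
Qed.

(** A set of diameter at most [r] contains at most one point of the family, so assigning a covering
    set to each point is injective. *)
Lemma separated_card_le (I : finType) (A : {pred I}) (x : I -> 'rV[R]_d) r E n :
  (forall i j, i \in A -> j \in A -> i != j -> r < edist (x i) (x j)) ->
  (forall i, i \in A -> E (x i)) -> diam_cover r E n -> (#|A| <= n)%N.
Proof.
move=> sep AE [U [Ur EU]]; case: n U Ur EU => [|n] U Ur EU.
  rewrite leqn0; apply/eqP; apply: eq_card0 => i; apply/negP => iA.
  by have [[]] := EU _ (AE _ iA).
have [f fU] : {f : I -> 'I_n.+1 & forall i, i \in A -> U (f i) (x i)}.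
  apply: (@choice _ _ (fun i k => i \in A -> U k (x i))) => i.
  have [iA|] := boolP (i \in A); last by exists ord0.
  by have [k _ Uk] := EU _ (AE _ iA); exists k.
have finj : {in A &, injective f}.
  move=> i j iA jA fij; apply/eqP; apply: contraT => ij.
  have := sep _ _ iA jA ij; rewrite ltNge (Ur (f i))//; first exact: fU.
  by rewrite fij; exact: fU.
by rewrite -(card_in_imset finj) (leq_trans (max_card _))// card_ord.
Qed.

Lemma separated_card_le_Ncov (I : finType) (A : {pred I}) (x : I -> 'rV[R]_d) r E :
  ebounded E -> 0 < r ->
  (forall i j, i \in A -> j \in A -> i != j -> r < edist (x i) (x j)) ->
  (forall i, i \in A -> E (x i)) -> #|A|%:R <= Ncov r E.
Proof.
move=> Eb r0 sep AE; have [n En] := ebounded_cover _ _ Eb r0.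
have [m Em ->] := Ncov_attained _ _ _ En.
by rewrite ler_nat (separated_card_le _ _ _ _ _ _ sep AE Em).
Qed.

(** A finite cover bounds the size of separated families, so a largest one exists; a point of [X]
    far from all its members could be added to it. *)
Lemma maximal_separated X r : ebounded X -> X !=set0 -> 0 < r ->
  exists n (x : 'I_n.+1 -> 'rV[R]_d),
    [/\ forall i, X (x i), forall i j, i != j -> r < edist (x i) (x j) &
        forall y, X y -> exists i, edist y (x i) <= r].
Proof.
move=> Xb [x0 Xx0] r0.
pose Q n := exists x : 'I_n.+1 -> 'rV[R]_d,
  (forall i, X (x i)) /\ forall i j, i != j -> r < edist (x i) (x j).
have [N XN] := ebounded_cover _ _ Xb r0.
have ex : exists n, `[< Q n >].
  exists 0%N; apply/asboolP; exists (fun=> x0); split=> // i j.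
  by rewrite (ord1 i) (ord1 j).
have QN n : `[< Q n >] -> (n <= N)%N.
  move=> /asboolP[x [Xx sep]]; apply: ltnW.
  have := @separated_card_le 'I_n.+1 predT x r X N.
  by rewrite card_ord; apply=> // i j _ _; exact: sep.
case: (ex_maxnP ex QN) => n /asboolP[x [Xx sep]] nmax.
exists n, x; split=> // y Xy; apply: contrapT => far.
have {}far i : r < edist y (x i).
  by rewrite ltNge; apply/negP => yx; apply: far; exists i.
have := nmax n.+1; rewrite ltnn => H; suff /H : `[< Q n.+1 >] by [].
(* The new point [y] takes index [0] and the old family is shifted by one. *)
apply/asboolP; exists (fun i => oapp x y (unlift ord0 i)); split.
  by move=> i; case: unliftP => [j _|_] /=.
move=> i j; case: (unliftP ord0 i) => [i' ->|->]; case: (unliftP ord0 j) => [j' ->|->] /=.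
- by rewrite (inj_eq lift_inj); exact: sep.
- by move=> _; rewrite edistC.
- by [].
- by rewrite ?eqxx.
Qed.

End Covers.

(** * Uniform measures on finitely many points *)

Section UniformMeasure.
Context {disp : measure_display} {T : measurableType disp} {R : realType}.
Variables (n : nat) (y : nat -> T).

Let weight : {nonneg R} := (n.+1%:R^-1)%:nng.

Definition uniform_on : set T -> \bar R :=
  mscale weight (msum (fun k => \d_(y k)) n.+1).

HB.instance Definition _ := Measure.on uniform_on.

Lemma uniform_onE (A : set T) :
  uniform_on A = (n.+1%:R^-1%:E * \sum_(k < n.+1) \d_(y k) A)%E.
Proof. by []. Qed.

Let uniform_onT : uniform_on setT = 1%E.
Proof.
rewrite uniform_onE; under eq_bigr do rewrite diracT.
by rewrite sumEFin sumr_const card_ord -EFinM mulVf.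
Qed.

HB.instance Definition _ :=
  Measure_isProbability.Build _ _ _ uniform_on uniform_onT.

Import HBNNSimple.

(* [f] need not be measurable: the integral of a nonnegative function is the
   supremum over the simple functions below it. *)
Lemma integral_uniform_on_le (f : T -> \bar R) : (forall x, 0 <= f x)%E ->
  (\int[uniform_on]_x f x <= n.+1%:R^-1%:E * \sum_(k < n.+1) f (y k))%E.
Proof.
move=> f0; rewrite ge0_integralTE//; apply: ge_ereal_sup => _ [h /= hf <-].
have mh : measurable_fun [set: T] (EFin \o h) by apply/measurable_EFinP.
have h0 x : (0 <= (h x)%:E)%E by rewrite lee_fin.
have -> : sintegral uniform_on h = (\int[uniform_on]_x (h x)%:E)%E.
  by rewrite integral_nnsfun// patch_setT.
rewrite ge0_integral_mscale// ge0_integral_measure_sum//.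
rewrite lee_wpmul2l//; apply: lee_sum => k _.
by rewrite integral_dirac// diracT mul1e.
Qed.

End UniformMeasure.

(** * A lower bound for integrals *)

Section IntegralBounds.
Context {disp : measure_display} {T : measurableType disp} {R : realType}.
Import HBNNSimple.

(** The simple function equal to [c] on [A] and [0] elsewhere lies below [f]. *)
Lemma integral_ge_cst_on (mu : {measure set T -> \bar R}) (A : set T)
    (f : T -> \bar R) (c : R) :
  measurable A -> 0 <= c -> (forall x, 0 <= f x)%E ->
  (forall x, A x -> c%:E <= f x)%E -> (c%:E * mu A <= \int[mu]_x f x)%E.
Proof.
move=> mA c0 f0 fc; rewrite ge0_integralTE//; apply: ereal_sup_ubound.
exists (scale_nnsfun (indic_nnsfun R mA) c0) => /=.
  move=> x; rewrite mindicE; have [/set_mem xA|_] := boolP (x \in A).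
    by rewrite mulr1; exact: fc.
  by rewrite mulr0.
by rewrite sintegralrM sintegral_indic.
Qed.

End IntegralBounds.

(** * Bounds on the inverse capacity *)

Section Capacity.
Variables (R : realType) (d : nat).
Implicit Types (X : set 'rV[R]_d) (s r : R).

Lemma phi_rs_ge0 s r (x : 'rV[R]_d) : 0 <= phi_rs s r x.
Proof. by rewrite /phi_rs; case: ifP => // _; rewrite le_min ler01 powR_ge0. Qed.

(** Balls of the topology are coordinatewise, so a point of the closure differs from some point of
    [X] by less than [1] in each coordinate. *)
Lemma ebounded_closure X : ebounded X -> ebounded (closure X).
Proof.
move=> [M XM]; exists (d.+1%:R * (`|M| + 1)) => x clx.
apply: enorm_le_coord => [|i]; first by rewrite addr_ge0.
have [y [Xy xy]] := clx _ (nbhsx_ballx x 1 ltr01).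
have xyi : `|x ord0 i - y ord0 i| < 1.
  by move: xy; rewrite /ball/= => [[_ xy]]; have := xy ord0 i; rewrite /ball/=.
have yi := le_trans (coord_le_enorm _ _ y i) (XM _ Xy).
rewrite -(subrK (y ord0 i) (x ord0 i)) (le_trans (ler_normD _ _))//.
rewrite [leRHS]addrC lerD ?(ltW xyi)//.
by rewrite (le_trans yi)// ler_norm.
Qed.

Lemma phi_rs_lower_bound s r X : 0 < s -> 0 < r -> ebounded X ->
  exists2 c : R, 0 < c & forall x y, X x -> X y -> c <= phi_rs s r (x - y).
Proof.
move=> s0 r0 [M XM].
pose D := 2 * (`|M| + 1); have D0 : 0 < D by rewrite mulr_gt0// ltr_wpDl.
exists (Order.min 1 ((r / D) `^ s)).
  by rewrite lt_min ltr01 powR_gt0// divr_gt0.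
move=> x y Xx Xy; rewrite /phi_rs; case: ifPn => [_|xy0].
  by rewrite ge_min lexx.
have xy_gt0 : 0 < enorm (x - y) by rewrite lt_def xy0 enorm_ge0.
have MM : M <= `|M| + 1 by rewrite (le_trans (ler_norm M))// lerDl.
have xyD : enorm (x - y) <= D.
  by apply: enormD_le2; rewrite ?enormN; apply: le_trans MM; exact: XM.
rewrite le_min !ge_min lexx/=; apply/orP; right.
apply: ge0_ler_powR;
  rewrite ?nnegrE ?divr_ge0 ?(ltW s0) ?(ltW r0) ?(ltW D0) ?(ltW xy_gt0)//.
by rewrite ler_pM2l// lef_pV2// posrE.
Qed.

(** An admissible measure gives mass [1] to the closure, where the kernel is at least [c]; bounding
    both integrals below gives energy at least [c]. Positivity keeps the inverse and the logarithm
    of the capacity away from their default values. *)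
Lemma inv_capacity_gt0 s r X : 0 < s -> 0 < r -> ebounded X ->
  (0 < inv_capacity s r X)%E.
Proof.
move=> s0 r0 Xb.
have [c c0 cphi] := phi_rs_lower_bound _ _ _ s0 r0 (ebounded_closure _ Xb).
rewrite (@lt_le_trans _ _ c%:E)//; apply: le_ereal_inf_tmp => _ [mu muX <-].
have mC : measurable (~` closure X : set (borelRd R d)).
  by apply: sub_sigma_algebra; exact/closed_openC/closed_closure.
have mX : measurable (closure X : set (borelRd R d)).
  by rewrite -[closure X]setCK; exact: measurableC.
have muX1 : mu (closure X) = 1%E.
  by have := probability_setC mu mC; rewrite setCK muX sube0.
have phi0 (x y : 'rV[R]_d) : (0 <= (phi_rs s r (x - y))%:E)%E.
  by rewrite lee_fin phi_rs_ge0.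
have bound (f : borelRd R d -> \bar R) : (forall x, 0 <= f x)%E ->
    (forall x, closure X x -> c%:E <= f x)%E -> (c%:E <= \int[mu]_x f x)%E.
  move=> f0 fc; rewrite -[leLHS]mule1 -muX1.
  exact: (integral_ge_cst_on mu _ f c mX (ltW c0)).
apply: (bound) => [x|x Xx]; first by apply: integral_ge0 => y _; exact: phi0.
by apply: bound => [y|y Xy]; [exact: phi0|rewrite lee_fin cphi].
Qed.

Lemma inv_capacity_le_mean s r X n (x : 'I_n.+1 -> 'rV[R]_d) :
  (forall i, X (x i)) ->
  (inv_capacity s r X <=
   (n.+1%:R^-1 * \sum_i (n.+1%:R^-1 * \sum_j phi_rs s r (x i - x j)))%:E)%E.
Proof.
(* [uniform_on] takes a sequence over [nat]; only its first [n.+1] terms carry mass. *)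
move=> Xx; pose y (k : nat) : borelRd R d := x (inord k).
have phi0 (u v : 'rV[R]_d) : (0 <= (phi_rs s r (u - v))%:E)%E.
  by rewrite lee_fin phi_rs_ge0.
have yE (i : 'I_n.+1) : y i = x i by rewrite /y inord_val.
apply: (@le_trans _ _ (energy s r (uniform_on n y))).
  apply: ereal_inf_lbound; exists (uniform_on n y) => //=.
  rewrite /supported_on /= uniform_onE big1 ?mule0// => k _.
  by rewrite diracE memNset//= => nX; apply: nX; apply: subset_closure; exact: Xx.
rewrite /energy (le_trans (integral_uniform_on_le _ _ _ _))//.
  by move=> u; apply: integral_ge0 => v _; exact: phi0.
rewrite EFinM lee_wpmul2l// -sumEFin; apply: lee_sum => i _.
rewrite (le_trans (integral_uniform_on_le _ _ _ _))//.
rewrite yE EFinM lee_wpmul2l// -sumEFin; apply: lee_sum => j _.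
by rewrite yE.
Qed.

End Capacity.

(** * Splitting the kernel over the scales [r^(1 - k tau)] *)

Section KernelScales.
Variables (R : realType) (d : nat).
Implicit Types (x : 'rV[R]_d) (s r tau : R).

Lemma powR_le_exp r (u v : R) : 0 < r -> r < 1 -> u <= v -> r `^ v <= r `^ u.
Proof. by move=> r0 r1 uv; apply: ger_powR => //; rewrite r0 ltW. Qed.

Lemma phi_rs_le1 s r x : phi_rs s r x <= 1.
Proof. by rewrite /phi_rs; case: ifP => // _; rewrite ge_min lexx. Qed.

(** Beyond the radius [r^(1 - t)] the quotient [r / |x|] is at most [r^t]. *)
Lemma phi_rs_le_scale s r (t : R) x : 0 < s -> 0 < r -> r `^ (1 - t) <= enorm x ->
  phi_rs s r x <= r `^ (s * t).
Proof.
move=> s0 r0 tx; have p0 : 0 < r `^ (1 - t) by exact: powR_gt0.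
have x0 : 0 < enorm x := lt_le_trans p0 tx.
rewrite /phi_rs gt_eqF// ge_min; apply/orP; right.
rewrite [s * t]mulrC powRrM; apply: ge0_ler_powR; rewrite ?nnegrE ?powR_ge0 ?(ltW s0)//.
  by rewrite divr_ge0// ltW.
rewrite ler_pdivrMr//; apply: (@le_trans _ _ (r `^ t * r `^ (1 - t))).
  rewrite -powRD; last by rewrite (gt_eqF r0) implybT.
  by rewrite addrC subrK powRr1// ltW.
by rewrite ler_wpM2l// powR_ge0.
Qed.

(** The term of the smallest ball containing [x] suffices: [x] lies outside the preceding ball,
    hence the shift by [tau] in the exponent. *)
Lemma phi_rs_le_sum_scales s r tau K x : 0 < s -> 0 < tau -> 0 < r -> r < 1 ->
  enorm x <= r `^ (1 - K%:R * tau) ->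
  phi_rs s r x <= \sum_(k < K.+1)
    r `^ (s * (k%:R * tau - tau)) * ((enorm x <= r `^ (1 - k%:R * tau))%R)%:R.
Proof.
move=> s0 t0 r0 r1 xK.
have ex : exists k, enorm x <= r `^ (1 - k%:R * tau) by exists K.
case: (ex_minnP ex) => m xm mmin.
have mK : (m < K.+1)%N by rewrite ltnS mmin.
rewrite (bigD1 (Ordinal mK))//= xm mulr1.
rewrite (@le_trans _ _ (r `^ (s * (m%:R * tau - tau))))//; last first.
  by rewrite lerDl sumr_ge0// => k _; rewrite mulr_ge0// powR_ge0.
case: m mmin {xm mK} => [|m] mmin.
  (* The innermost ball has no predecessor; its weight [r^(- s tau)] is at least [1], which bounds
     the kernel. *)
  rewrite (le_trans (phi_rs_le1 _ _ _))// -(powRr0 r) powR_le_exp//.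
  by rewrite mul0r sub0r mulrN oppr_le0 mulr_ge0// ltW.
have -> : m.+1%:R * tau - tau = m%:R * tau by rewrite -natr1; lra.
apply: phi_rs_le_scale => //; rewrite leNgt; apply/negP => /ltW /mmin.
by rewrite ltnn.
Qed.

(** Exchanging the two sums turns the indicators into numbers of points in balls. *)
Lemma sum_phi_rs_le s r tau K n (x : 'I_n -> 'rV[R]_d) i (B : R) :
  0 < s -> 0 < tau -> 0 < r -> r < 1 ->
  (forall j, edist (x i) (x j) <= r `^ (1 - K%:R * tau)) ->
  (forall k : nat, r `^ (s * (k%:R * tau - tau)) *
     #|[pred j | edist (x i) (x j) <= r `^ (1 - k%:R * tau)]|%:R <= B) ->
  \sum_j phi_rs s r (x i - x j) <= K.+1%:R * B.
Proof.
move=> s0 t0 r0 r1 xK HB.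
have phi_le j := phi_rs_le_sum_scales _ _ _ _ _ s0 t0 r0 r1 (xK j).
rewrite (le_trans (ler_sum _ (fun j _ => phi_le j)))//.
rewrite exchange_big/= mulr_natl -[in leRHS](card_ord K.+1) -sumr_const.
apply: ler_sum => k _; apply: le_trans (HB k).
rewrite -mulr_sumr -natr_sum -sum1_card [in leRHS]big_mkcond/=.
by rewrite ler_wpM2l ?powR_ge0// ler_nat.
Qed.

End KernelScales.

(** * Counting separated points in balls *)

Section Counting.
Variables (R : realType) (d : nat).
Implicit Types (X : set 'rV[R]_d) (s r rho theta tau a b C : R).

Definition assouad_bound X a C := forall r rho x, 0 < r -> r < rho -> X x ->
  Ncov r (eball x rho `&` X) <= C * (rho / r) `^ a.

Definition spectrum_bound theta X b C := forall r rho x, 0 < r ->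
  r <= rho `^ theta^-1 -> rho `^ theta^-1 < rho -> rho < 1 -> X x ->
  Ncov r (eball x rho `&` X) <= C * (rho / r) `^ b.

(** With [e = theta^-1] this is the strict inequality required in the spectrum bound. *)
Lemma powR_lt_base rho (e : R) : 0 < rho -> rho < 1 -> 1 < e -> rho `^ e < rho.
Proof.
move=> rho0 rho1 e1; rewrite -[ltRHS]powRr1 ?ltW// ltNge; apply/negP => H.
have : ln (rho `^ 1) <= ln (rho `^ e) by rewrite ler_ln ?posrE ?powR_gt0.
rewrite !ln_powR; have ln0 : ln rho < 0 by rewrite ln_lt0// rho0 rho1.
by nra.
Qed.

Lemma card_ball_le_Ncov X r n (x : 'I_n -> 'rV[R]_d) i rho :
  ebounded X -> 0 < r -> (forall i, X (x i)) ->
  (forall i j, i != j -> r < edist (x i) (x j)) ->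
  #|[pred j | edist (x i) (x j) <= rho]|%:R <= Ncov r (eball (x i) rho `&` X).
Proof.
move=> [M XM] r0 Xx sep; apply: (separated_card_le_Ncov R d _ _ x) => //.
- by exists M => y [_ /XM].
- by move=> j k _ _; exact: sep.
- by move=> j; rewrite inE => ij; split; [rewrite /eball/= edistC|exact: Xx].
Qed.

(** The points falling in one set of diameter [1/2] lie in a ball of radius [1/2] about any of them;
    there the spectrum bound at scale [r / 2] has ratio [1 / r]. *)
Lemma card_le_spectrum X theta b C M r n (x : 'I_n -> 'rV[R]_d) :
  ebounded X -> 0 < theta -> theta < 1 -> 0 < C -> spectrum_bound theta X b C ->
  0 < r -> (forall i, X (x i)) ->
  (forall i j, i != j -> r / 2 < edist (x i) (x j)) ->
  diam_cover R d (2^-1) X M -> r <= 2^-1 `^ theta^-1 ->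
  n%:R <= M%:R * C * r `^ (- b).
Proof.
move=> Xb theta0 theta1 C0 specX r0 Xx sep [U [Ud XU]] rsmall.
have r20 : 0 < r / 2 by rewrite divr_gt0.
have [f fU] : {f : 'I_n -> 'I_M & forall i, U (f i) (x i)}.
  apply: (@choice _ _ (fun i k => U k (x i))) => i.
  by have [k _ Uk] := XU _ (Xx i); exists k.
have -> : n%:R = \sum_(k < M) #|[pred i | f i == k]|%:R :> R.
  rewrite -natr_sum -[in LHS](card_ord n) -sum1_card; congr _%:R.
  rewrite (partition_big f predT)//=; apply: eq_bigr => k _.
  by rewrite sum1_card; apply: eq_card.
rewrite -mulrA mulr_natl -[in leRHS](card_ord M) -sumr_const.
apply: ler_sum => k _.
have [/existsP[i /eqP fi]|/existsPn nf] := boolP [exists i, f i == k]; last first.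
  by rewrite eq_card0 ?mulr_ge0 ?powR_ge0 ?(ltW C0)// => i; rewrite inE (negbTE (nf i)).
apply: (@le_trans _ _ #|[pred j | edist (x i) (x j) <= 2^-1]|%:R).
  rewrite ler_nat; apply: subset_leq_card; apply/fintype.subsetP => j.
  rewrite !inE => /eqP fj.
  by apply: (Ud k); [rewrite -fi|rewrite -fj].
rewrite (le_trans (card_ball_le_Ncov _ _ _ _ i _ Xb r20 Xx sep))//.
rewrite (le_trans (specX _ _ _ r20 _ _ _ (Xx i)))//.
- by rewrite (le_trans _ rsmall)//; lra.
- by apply: powR_lt_base; [lra|lra|rewrite invf_gt1].
- lra.
- have -> : 2^-1 / (r / 2) = r^-1 by field; rewrite gt_eqF.
  by rewrite -powR_inv1 ?(ltW r0)// -powRrM mulN1r.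
Qed.

Lemma scale_ratio_powR r (t e : R) : 0 < r ->
  (r `^ (1 - t) / (r / 2)) `^ e = 2 `^ e * r `^ (- (t * e)).
Proof.
move=> r0; have -> : r `^ (1 - t) / (r / 2) = 2 * r `^ (- t).
  rewrite powRD ?(gt_eqF r0) ?implybT// powRr1 ?ltW//.
  by field; rewrite gt_eqF.
by rewrite powRM ?powR_ge0// -powRrM mulNr.
Qed.

(** The weight contributes exponent [s (t - tau)] and the count [- t a], [- t b] or [- b], according
    to the size of the radius; the conditions on [m] keep each total at least [- (m + s tau)]. *)
Lemma weighted_card_ball_le X s theta a b m Ca Cb Ct tau t r n
    (x : 'I_n -> 'rV[R]_d) i :
  ebounded X -> 0 < s -> 0 < theta -> theta < 1 -> 0 < Ca -> 0 < Cb ->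
  assouad_bound X a Ca -> spectrum_bound theta X b Cb ->
  0 <= m -> (a - s) * (1 - theta) <= m -> b - s <= m ->
  0 < r -> r < 1 -> (forall i, X (x i)) ->
  (forall i j, i != j -> r / 2 < edist (x i) (x j)) ->
  n%:R <= Ct * r `^ (- b) -> 0 <= t -> 0 <= tau ->
  r `^ (s * (t - tau)) * #|[pred j | edist (x i) (x j) <= r `^ (1 - t)]|%:R
  <= (Ca * 2 `^ a + Cb * 2 `^ b + Ct) * r `^ (- (m + s * tau)).
Proof.
move=> Xb s0 theta0 theta1 Ca0 Cb0 assouadX specX m0 am bm r0 r1 Xx sep nCt t0 tau0.
have r20 : 0 < r / 2 by rewrite divr_gt0.
set c : R := #|_|%:R; set e := - (m + s * tau).
have cn : c <= n%:R by rewrite ler_nat (leq_trans (max_card _))// card_ord.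
have Ct0 : 0 <= Ct.
  by rewrite -(pmulr_lge0 _ (powR_gt0 (- b) r0)) (le_trans _ nCt).
have A0 : 0 <= Ca * 2 `^ a by rewrite mulr_ge0 ?powR_ge0// ltW.
have B0 : 0 <= Cb * 2 `^ b by rewrite mulr_ge0 ?powR_ge0// ltW.
have e0 : 0 <= r `^ e by exact: powR_ge0.
have step (K u : R) : 0 <= K -> c <= K * r `^ u -> e <= s * (t - tau) + u ->
    r `^ (s * (t - tau)) * c <= K * r `^ e.
  move=> K0 cK eu; apply: (@le_trans _ _ (r `^ (s * (t - tau)) * (K * r `^ u))).
    by rewrite ler_wpM2l// powR_ge0.
  rewrite mulrCA ler_wpM2l// -powRD ?(gt_eqF r0) ?implybT//.
  exact: powR_le_exp.
(* Separation [r / 2] instead of [r] makes this strict even at [t = 0]. *)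
have rho_ge : r / 2 < r `^ (1 - t).
  apply: (@lt_le_trans _ _ (r `^ 1)); first by rewrite powRr1 ?ltW//; lra.
  by apply: powR_le_exp => //; lra.
have [t_le|t_gt] := leP t (1 - theta).
  apply: (@le_trans _ _ (Ca * 2 `^ a * r `^ e)); last by nra.
  apply: (step _ (- (t * a))) => //.
    rewrite (le_trans (card_ball_le_Ncov _ _ _ _ i _ Xb r20 Xx sep))//.
    by rewrite (le_trans (assouadX _ _ _ r20 rho_ge (Xx i)))// scale_ratio_powR// mulrA.
  (* If [a >= s], use [t <= 1 - theta]; otherwise the left side is at most [0]. *)
  have : t * (a - s) <= m by have [|] := leP s a; nra.
  by rewrite /e; lra.
have [t1|t_ge1] := ltP t 1.
  apply: (@le_trans _ _ (Cb * 2 `^ b * r `^ e)); last by nra.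
  apply: (step _ (- (t * b))) => //.
    rewrite (le_trans (card_ball_le_Ncov _ _ _ _ i _ Xb r20 Xx sep))//.
    have p1 : r `^ (1 - t) < 1.
      rewrite ltNge; apply/negP => /ln_ge0; rewrite ln_powR.
      have : ln r < 0 by rewrite ln_lt0// r0 r1.
      by nra.
    rewrite (le_trans (specX _ _ _ r20 _ _ p1 (Xx i)))//.
    (* Since [t > 1 - theta], the exponent [(1 - t) / theta] is below [1]. *)
    - rewrite -powRrM (@le_trans _ _ (r `^ 1))//; first by rewrite powRr1 ?ltW//; lra.
      by apply: powR_le_exp => //; rewrite ler_pdivrMr//; lra.
    - by apply: powR_lt_base; [exact: powR_gt0|exact: p1|rewrite invf_gt1].
    - by rewrite scale_ratio_powR// mulrA.
  have : t * (b - s) <= m by have [|] := leP s b; nra.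
  by rewrite /e; lra.
(* Once the radius is at least [1], all [n] points are counted, and [s t >= s] pays for the exponent
   [b]. *)
apply: (@le_trans _ _ (Ct * r `^ e)); last by nra.
apply: (step _ (- b)) => //; first exact: le_trans nCt.
by rewrite /e; nra.
Qed.

Lemma inv_capacity_upper_bound X s theta a b m Ca Cb tau (K : nat) :
  ebounded X -> X !=set0 -> 0 < s -> 0 < theta -> theta < 1 -> 0 < Ca -> 0 < Cb ->
  assouad_bound X a Ca -> spectrum_bound theta X b Cb ->
  0 <= m -> (a - s) * (1 - theta) <= m -> b - s <= m ->
  0 < tau -> 1 < K%:R * tau ->
  exists C r0 : R, [/\ 0 < C, 0 < r0, r0 < 1 & forall r, 0 < r -> r < r0 ->
    exists n : nat, Ncov r X <= n.+1%:R /\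
      (inv_capacity s r X <= (n.+1%:R^-1 * (C * r `^ (- (m + s * tau))))%:E)%E].
Proof.
move=> Xb Xne s0 theta0 theta1 Ca0 Cb0 assouadX specX m0 am bm tau0 Ktau.
have half0 : 0 < 2^-1 :> R by rewrite invr_gt0.
have [M XM] := ebounded_cover _ _ _ _ Xb half0.
have [L XL] := Xb; pose D := 2 * (`|L| + 1).
have D1 : 1 < D by rewrite /D; have := normr_ge0 L; lra.
have D0 : 0 < D by lra.
pose Ct := M%:R * Cb; have Ct0 : 0 <= Ct by rewrite mulr_ge0// ltW.
pose C1 := Ca * 2 `^ a + Cb * 2 `^ b + Ct.
have C10 : 0 < C1.
  by rewrite ltr_wpDr// addr_gt0// mulr_gt0// powR_gt0.
(* The outermost radius is [r^(- g)]. The second threshold on [r] makes it at least [D], which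
   bounds all distances in [X]; the first allows the spectrum bound at radius [1/2]. *)
pose g := K%:R * tau - 1; have g0 : 0 < g by rewrite /g; lra.
exists (K.+1%:R * C1), (Num.min (2^-1 `^ theta^-1) (D^-1 `^ g^-1)); split.
- by rewrite mulr_gt0.
- by rewrite lt_min !powR_gt0// invr_gt0.
- rewrite gt_min; apply/orP; left.
  by apply: (@lt_trans _ _ 2^-1); [apply: powR_lt_base; [lra|lra|rewrite invf_gt1]|lra].
move=> r r0; rewrite lt_min => /andP[r_theta r_D].
have r1 : r < 1.
  apply: (lt_trans r_theta); apply: (@lt_trans _ _ 2^-1); last lra.
  by apply: powR_lt_base; [lra|lra|rewrite invf_gt1].
have r20 : 0 < r / 2 by rewrite divr_gt0.
have [n [x [Xx sep xcov]]] := maximal_separated _ _ _ _ Xb Xne r20.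
exists n; split.
  (* By maximality the balls of radius [r / 2] about the points cover [X], and their diameters are
     at most [r]. *)
  apply: Ncov_le; exists (fun i => [set y | edist y (x i) <= r / 2]); split.
    move=> i y z /= yi zi; have := edist_le2 _ _ _ _ _ _ yi zi.
    by rewrite mulrC divfK.
  by move=> y /xcov[i yi]; exists i.
have nCt : n.+1%:R <= Ct * r `^ (- b).
  by apply: (card_le_spectrum X theta b Cb M r n.+1 x) => //; exact: ltW.
have far i j : edist (x i) (x j) <= r `^ (1 - K%:R * tau).
  apply: (@le_trans _ _ D).
    have LD : L <= `|L| + 1 by rewrite (le_trans (ler_norm L))// lerDl.
    by apply: enormD_le2; rewrite ?enormN; apply: le_trans LD; exact: XL.
  rewrite -opprB -/g powRN -[leLHS]invrK lef_pV2 ?posrE ?powR_gt0 ?invr_gt0//.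
  have -> : D^-1 = (D^-1 `^ g^-1) `^ g.
    by rewrite -powRrM mulVf ?gt_eqF// powRr1// invr_ge0 ltW.
  apply: ge0_ler_powR; rewrite ?nnegrE ?powR_ge0 ?(ltW g0) ?(ltW r0)//.
  exact: ltW.
rewrite (le_trans (inv_capacity_le_mean _ _ s r X n x Xx))// lee_fin.
rewrite ler_wpM2l ?invr_ge0//.
rewrite -[leRHS](mulKf (x := n.+1%:R)) ?pnatr_eq0// -mulr_sumr ler_wpM2l ?invr_ge0//.
rewrite mulr_natl -[in leRHS](card_ord n.+1) -sumr_const; apply: ler_sum => i _.
rewrite -mulrA; apply: (sum_phi_rs_le _ _ _ _ tau) => // k.
apply: (weighted_card_ball_le X s theta a b m) => //; last exact: ltW.
by rewrite mulr_ge0// ltW.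
Qed.

End Counting.

(** * From capacity bounds to dimensions *)

Section Dimensions.
Variables (R : realType) (d : nat).
Implicit Types (X : set 'rV[R]_d) (f g : R -> R).

Lemma limsup0_le_add f g (c delta0 : R) : 0 < delta0 ->
  (forall r, 0 < r -> r < delta0 -> f r <= g r + c) ->
  (limsup0 f <= limsup0 g + c%:E)%E.
Proof.
move=> d0 fg; rewrite -leeBlDr//; apply: le_ereal_inf_tmp => _ [delta delta0' <-].
rewrite leeBlDr//; pose eta := Num.min delta delta0.
apply: (@le_trans _ _ (ereal_sup [set (f r)%:E | r in [set r | 0 < r < eta]])).
  by apply: ereal_inf_lbound; exists eta => //=; rewrite lt_min delta0' d0.
apply: ge_ereal_sup => _ [r /= /andP[r0 reta] <-].
move: reta; rewrite lt_min => /andP[rd rd0].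
apply: (@le_trans _ _ ((g r)%:E + c%:E)%E); first by rewrite -EFinD lee_fin fg.
by apply: leeD2r; apply: ereal_sup_ubound; exists r => //=; rewrite r0 rd.
Qed.

(** Here [v] stands for the inverse capacity. Taking logarithms cancels [n.+1], and [e] absorbs the
    constant [C]. *)
Lemma log_ratio_le (N v C q e r : R) (n : nat) :
  0 < r -> r < 1 -> 0 < C -> ln C <= e * - ln r -> N <= n.+1%:R -> 0 < v ->
  v <= n.+1%:R^-1 * (C * r `^ (- q)) ->
  ln N / - ln r <= ln v^-1 / - ln r + (q + e).
Proof.
move=> r0 r1 C0 Ce Nn v0 vle.
have L0 : 0 < - ln r by rewrite oppr_gt0 ln_lt0// r0 r1.
have lnN : ln N <= ln n.+1%:R.
  have [N0|N0] := ltP 0 N; first by rewrite ler_ln ?posrE.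
  (* For [N <= 0] the logarithm takes its default value [0]. *)
  by rewrite ln0// ln_ge0// ler1n.
have lnv : ln v <= - ln n.+1%:R + (ln C - q * ln r).
  have p0 : 0 < r `^ (- q) by exact: powR_gt0.
  rewrite -mulNr -(ln_powR r) -lnM ?posrE// -lnV ?posrE//.
  rewrite -lnM ?posrE ?invr_gt0 ?mulr_gt0//.
  by rewrite ler_ln ?posrE// !mulr_gt0// invr_gt0.
rewrite lnV ?posrE// ler_pdivrMr// mulrDl divfK ?gt_eqF//.
by lra.
Qed.

Lemma ubox_dim_le_profile X (s theta a b m Ca Cb e : R) :
  ebounded X -> X !=set0 -> 0 < s -> 0 < theta -> theta < 1 -> 0 < Ca -> 0 < Cb ->
  assouad_bound R d X a Ca -> spectrum_bound R d theta X b Cb ->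
  0 <= m -> (a - s) * (1 - theta) <= m -> b - s <= m -> 0 < e ->
  (ubox_dim X <= ubox_profile s X + (m + 2 * e)%:E)%E.
Proof.
move=> Xb Xne s0 theta0 theta1 Ca0 Cb0 assouadX specX m0 am bm e0.
(* This choice gives [s * tau = e], one half of the loss [2 * e]; the other half pays for [ln C]. *)
pose tau := e / s; have tau0 : 0 < tau by rewrite divr_gt0.
pose K := (Num.truncn tau^-1).+1.
have Ktau : 1 < K%:R * tau by rewrite -ltr_pdivrMr// mul1r truncnS_gt.
have [C [r0 [C0 r00 r01 capX]]] := inv_capacity_upper_bound R d X s theta a b m
  Ca Cb tau K Xb Xne s0 theta0 theta1 Ca0 Cb0 assouadX specX m0 am bm tau0 Ktau.
have stau : s * tau = e by rewrite /tau mulrC divfK ?gt_eqF.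
(* Below the exponential threshold, [|ln C|] is at most [e * - ln r]. *)
apply: (limsup0_le_add _ _ _ (Num.min r0 (expR (- (`|ln C| / e))))).
  by rewrite lt_min r00 expR_gt0.
move=> r r_gt0; rewrite lt_min => /andP[r_lt r_exp].
have r1 : r < 1 := lt_trans r_lt r01.
have [n [Nn inv_le]] := capX r r_gt0 r_lt.
have inv_gt0 := inv_capacity_gt0 _ _ s r X s0 r_gt0 Xb.
have inv_fin : inv_capacity s r X \is a fin_num.
  by rewrite ge0_fin_numE ?ltW// (le_lt_trans inv_le)// ltry.
rewrite /capacity (_ : m + 2 * e = m + s * tau + e); last by rewrite stau; lra.
apply: (@log_ratio_le _ _ C _ _ _ n) => //.
- have lnr : ln r < - (`|ln C| / e).
    by rewrite -(expRK (- (`|ln C| / e))) ltr_ln ?posrE ?expR_gt0.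
  by rewrite (le_trans (ler_norm _))// -ler_pdivrMl// mulrC; lra.
- by rewrite fine_gt0// inv_gt0 -ge0_fin_numE ?inv_fin// ltW.
- by rewrite -lee_fin fineK.
Qed.

End Dimensions.

(** * Extended real values and the choice of admissible exponents *)

Theorem theorem4p3 (R : realType) (d : nat) (s theta : R) (X : set 'rV[R]_d) :
  0 < s -> s <= d%:R -> 0 < theta -> theta < 1 ->
  X !=set0 -> ebounded X ->
  (ubox_dim X - Order.max 0
      (Order.max (upper_assouad_spectrum theta X - s%:E)
                 ((assouad_dim X - s%:E) * (1 - theta)%:E)) <=
   ubox_profile s X)%E.
Proof.
move=> s0 _ theta0 theta1 Xne Xb.
set M := Order.max 0%E _.
have M0 : (0 <= M)%E by rewrite le_max lexx.
have specM : (upper_assouad_spectrum theta X - s%:E <= M)%E.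
  by rewrite !le_max lexx !orbT.
have assM : ((assouad_dim X - s%:E) * (1 - theta)%:E <= M)%E.
  by rewrite !le_max lexx !orbT.
case: M M0 specM assM => [m| |//]; last first.
  (* [x - +oo = -oo] for every [x], including [x = +oo]. *)
  by move=> _ _ _; rewrite addeNy leNye.
rewrite lee_fin => m0 specM assM.
(* One [h] leaves room to choose exponents [a] and [b] above the two infima; the other two are the
   loss [2 * h] of [ubox_dim_le_profile]. *)
rewrite leeBlDr//; apply/lee_addgt0Pr => e e0; pose h := e / 3.
have h0 : 0 < h by rewrite divr_gt0.
have th : 0 < 1 - theta by lra.
have : (upper_assouad_spectrum theta X < (m + h + s)%:E)%E.
  move: specM; case: (upper_assouad_spectrum theta X) => [v| |]//=.
    by rewrite -EFinB lee_fin lte_fin; lra.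
  by rewrite ltNyr.
move=> /ereal_inf_lt[_ [b [Cb [Cb0 specX]] <-]]; rewrite lte_fin => bm.
have : (assouad_dim X < ((m + h) / (1 - theta) + s)%:E)%E.
  move: assM; case: (assouad_dim X) => [v| |]//=.
  - rewrite -EFinB -EFinM lee_fin lte_fin => vm.
    by rewrite -ltrBlDr ltr_pdivlMr//; lra.
  (* An infinite Assouad dimension would make the product infinite, as [1 - theta > 0], against the
     bound [m]. *)
  - by rewrite mulyr gtr0_sg// mul1e.
  - by rewrite ltNyr.
move=> /ereal_inf_lt[_ [a [_ [Ca [Ca0 assX]]] <-]]; rewrite lte_fin => am.
have -> : (ubox_profile s X + m%:E + e%:E = ubox_profile s X + (m + h + 2 * h)%:E)%E.
  by rewrite -addeA -EFinD; congr (_ + _%:E)%E; rewrite /h; lra.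
apply: (ubox_dim_le_profile R d X s theta a b (m + h) Ca Cb h) => //.
- by rewrite addr_ge0// ltW.
- by rewrite -ler_pdivlMr//; lra.
- lra.
Qed.
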